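(* There are universal constants $\mathcal{C}_0 > 1$ and $\mathcal{C}_1 > \frac14$ such that the following holds. Let $n,d,m$ be positive integers, $\delta\in(0,1)$, $0<\varepsilon<\frac12$, $c\in\mathbb{R}^n$, $b\in\mathbb{R}^m$, and let $A\in\mathbb{R}^{m\times n}$ have rows that are unit vectors. Assume that $S^*=\{x\in\mathbb{R}^n\mid Ax\le b,\ \|x\|\le1\}$ is full-dimensional. Let $P\in\mathbb{R}^{d\times n}$ be a random matrix whose entries are i.i.d. centered Gaussian random variables with standard deviation $\frac{1}{\sqrt n}$, and suppose $$d\ge \frac{\log(m/\delta)}{\mathcal{C}_0\varepsilon^2}\quad\text{and}\quad n\ge\frac{(d+1)\log(\frac{2d}{\delta})}{\mathcal{C}_1\varepsilon^2}.$$ Let $u_\varepsilon^-$, $u_\varepsilon^+$ be optimal solutions of the projected problems $(P^-_\varepsilon)$, $(P^+_\varepsilon)$ respectively, and put $x_\varepsilon^-=P^\top u_\varepsilon^-$, $x_\varepsilon^+=P^\top u_\varepsilon^+$. Then with probability at least $1-2\delta$, $$c^\top x_\varepsilon^+\ \le\ c^\top x_\varepsilon^-\ \le\ c^\top x_\varepsilon^+ +\frac{18\,\varepsilon}{\mathrm{FULL}(S^* )}\|c\|.$$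
   Context: $\|\cdot\|$ is the Euclidean norm. Inequalities between vectors are componentwise, and $b+\varepsilon$ denotes the vector obtained from $b$ by adding $\varepsilon$ to every coordinate. For a set $S$ in a Euclidean space, the fullness measure $\mathrm{FULL}(S)$ is the maximum radius of a closed ball contained in $S$. Given $P\in\mathbb{R}^{d\times n}$, the projected problems are $$(P^-_\varepsilon):\ \min\{(Pc)^\top u \mid AP^\top u\le b,\ \|u\|\le 1-\varepsilon,\ u\in\mathbb{R}^d\},$$ $$(P^+_\varepsilon):\ \min\{(Pc)^\top u \mid AP^\top u\le b+\varepsilon,\ \|u\|\le 1+\varepsilon,\ u\in\mathbb{R}^d\}.$$ Standing assumption: $(P^-_\varepsilon)$ is feasible (hence so is $(P^+_\varepsilon)$), so that optimal solutions exist. *)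

(* Defs.v *)
From HB Require Import structures.
From mathcomp Require Import all_boot all_order all_algebra.
From mathcomp Require Import all_classical all_reals all_analysis.

Set Implicit Arguments.
Unset Strict Implicit.
Unset Printing Implicit Defensive.

Import Order.TTheory GRing.Theory Num.Theory.

Local Open Scope classical_set_scope.
Local Open Scope ring_scope.

Section Euclidean.
Context {R : realType}.

Definition dotv (n : nat) (x y : 'cV[R]_n) : R := (x^T *m y) 0 0.

(* The library norm on matrices is the sup norm, so the Euclidean norm is
   defined here. *)
Definition enorm (n : nat) (x : 'cV[R]_n) : R := Num.sqrt (dotv x x).

Definition lecv (m : nat) (x y : 'cV[R]_m) : Prop :=
  forall i, x i 0 <= y i 0.

Definition closed_eball (n : nat) (x : 'cV[R]_n) (r : R) : set 'cV[R]_n :=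
  [set y | enorm (y - x) <= r].

Definition affine_hull (n : nat) (S : set 'cV[R]_n) : set 'cV[R]_n :=
  [set y | exists (k : nat) (x : 'I_k -> 'cV[R]_n) (l : 'I_k -> R),
    [/\ forall i, S (x i), \sum_(i < k) l i = 1
      & y = \sum_(i < k) l i *: x i]].

Definition full_dimensional (n : nat) (S : set 'cV[R]_n) : Prop :=
  affine_hull S = setT.

(* The supremum is a maximum whenever S is compact and nonempty. *)
Definition fullness (n : nat) (S : set 'cV[R]_n) : R :=
  sup [set r | 0 <= r /\ exists x, closed_eball x r `<=` S].

Definition is_argmin (n : nat) (f : 'cV[R]_n -> R) (F : set 'cV[R]_n)
    (u : 'cV[R]_n) : Prop :=
  F u /\ forall v, F v -> f u <= f v.

Definition ball_polytope (m n : nat) (A : 'M[R]_(m, n)) (b : 'cV[R]_m) :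
    set 'cV[R]_n :=
  [set x | lecv (A *m x) b /\ enorm x <= 1].

Section Projected.
Variables (m n d : nat) (A : 'M[R]_(m, n)) (b : 'cV[R]_m) (c : 'cV[R]_n).
Variables (P : 'M[R]_(d, n)) (eps : R).

Definition proj_obj (u : 'cV[R]_d) : R := dotv (P *m c) u.

Definition feas_minus : set 'cV[R]_d :=
  [set u | lecv (A *m P^T *m u) b /\ enorm u <= 1 - eps].

Definition feas_plus : set 'cV[R]_d :=
  [set u | lecv (A *m P^T *m u) (b + const_mx eps) /\ enorm u <= 1 + eps].

End Projected.

End Euclidean.

Section Probability.
Context {disp : measure_display} {T : measurableType disp} {R : realType}.
Variable Pr : probability T R.

Definition mutually_independent (I : finType) (X : I -> T -> R) : Prop :=
  forall (J : {set I}) (B : I -> set R), (forall i, measurable (B i)) ->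
    Pr [set w | forall i, i \in J -> B i (X i w)] =
    (\prod_(i in J) fine (Pr (X i @^-1` B i)))%:E.

(* In normal_prob 0 s, the parameter s is the standard deviation. *)
Definition iid_gaussian_matrix (d n : nat) (s : R) (P : T -> 'M[R]_(d, n)) :
    Prop :=
  [/\ forall i j, measurable_fun setT (fun w => P w i j),
      forall i j (B : set R), measurable B ->
        Pr ((fun w => P w i j) @^-1` B) = normal_prob 0 s B
    & mutually_independent
        (fun (ij : 'I_d * 'I_n) (w : T) => P w ij.1 ij.2)].

(* Inner probability: for a measurable E this says p%:E <= Pr E, and it makes
   sense for events not known in advance to be measurable. *)
Definition with_probability_ge (p : R) (E : set T) : Prop :=
  exists F : set T, [/\ measurable F, F `<=` E & (p%:E <= Pr F)%E].

End Probability.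

(* Main.v *)
Require Import Defs.
From HB Require Import structures.
From mathcomp Require Import all_boot all_order all_algebra.
From mathcomp Require Import all_classical all_reals all_analysis.
From mathcomp Require Import measurable_realfun ring lra.

(* Since [(P w)^T *m u] pairs with [c] as [u] pairs with [P w *m c], the two
   optimal values differ by at most [2 * enorm (P w *m c)].  The matrix [P w]
   squeezes [R^n] into a space of much smaller dimension: the coordinates of
   [P w *m c] are centered Gaussian with variance [enorm c ^+ 2 / n], so the
   lower bound on [n], Chernoff's inequality and a union bound over the [d]
   coordinates give [enorm (P w *m c) <= 9 * eps * enorm c] with probability at
   least [1 - delta].  Since [0 < fullness <= 1], this implies the bound. *)

Set Implicit Arguments.
Unset Strict Implicit.
Unset Printing Implicit Defensive.

Import Order.TTheory GRing.Theory Num.Theory.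
Local Open Scope classical_set_scope.
Local Open Scope ring_scope.

(** * Euclidean inner product and norm, and affine hulls *)

Section euclidean.
Context {R : realType}.

Lemma dotvE n (x y : 'cV[R]_n) : dotv x y = \sum_i x i 0 * y i 0.
Proof. by rewrite /dotv mxE; apply: eq_bigr => i _; rewrite mxE. Qed.

Lemma dotvC n (x y : 'cV[R]_n) : dotv x y = dotv y x.
Proof. by rewrite !dotvE; apply: eq_bigr => i _; rewrite mulrC. Qed.

Lemma dotvDr n (x y z : 'cV[R]_n) : dotv x (y + z) = dotv x y + dotv x z.
Proof. by rewrite /dotv mulmxDr mxE. Qed.

Lemma dotvZr n a (x y : 'cV[R]_n) : dotv x (a *: y) = a * dotv x y.
Proof. by rewrite /dotv -scalemxAr mxE. Qed.

Lemma dotvNr n (x y : 'cV[R]_n) : dotv x (- y) = - dotv x y.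
Proof. by rewrite -scaleN1r dotvZr mulN1r. Qed.

Lemma dotv_sumr n (I : finType) (x : 'cV[R]_n) (y : I -> 'cV[R]_n) :
  dotv x (\sum_i y i) = \sum_i dotv x (y i).
Proof. by rewrite /dotv mulmx_sumr summxE. Qed.

Lemma dotv_trmul d n (P : 'M[R]_(d, n)) (c : 'cV[R]_n) (u : 'cV[R]_d) :
  dotv c (P^T *m u) = dotv (P *m c) u.
Proof. by rewrite /dotv mulmxA trmx_mul. Qed.

Lemma mulmx_dotv m n (A : 'M[R]_(m, n)) (x : 'cV[R]_n) i :
  (A *m x) i 0 = dotv (row i A)^T x.
Proof. by rewrite /dotv trmxK -row_mul [RHS]mxE. Qed.

Lemma dotvv_ge0 n (x : 'cV[R]_n) : 0 <= dotv x x.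
Proof. by rewrite dotvE sumr_ge0// => i _; rewrite -expr2 sqr_ge0. Qed.

Lemma dotvv_eq0 n (x : 'cV[R]_n) : (dotv x x == 0) = (x == 0).
Proof.
apply/eqP/eqP => [|->]; last by rewrite /dotv mulmx0 mxE.
rewrite dotvE => /eqP; rewrite psumr_eq0; last first.
  by move=> i _; rewrite -expr2 sqr_ge0.
move=> /allP x0; apply/colP => i; rewrite mxE; apply/eqP.
by have := x0 i (mem_index_enum i); rewrite /= mulf_eq0 orbb.
Qed.

Lemma enorm_ge0 n (x : 'cV[R]_n) : 0 <= enorm x.
Proof. exact: sqrtr_ge0. Qed.

Lemma sqr_enorm n (x : 'cV[R]_n) : enorm x ^+ 2 = dotv x x.
Proof. by rewrite sqr_sqrtr// dotvv_ge0. Qed.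

(** Cauchy-Schwarz: for nonzero vectors, the squared norm of [enorm y *: x - enorm x *: y] equals
    [2 * a * b * (a * b - dotv x y)], where [a] and [b] are the two norms, and it is nonnegative. *)
Lemma dotv_le_enorm n (x y : 'cV[R]_n) : dotv x y <= enorm x * enorm y.
Proof.
have [->|x0] := eqVneq x 0.
  by rewrite /dotv trmx0 mul0mx mxE mulr_ge0// enorm_ge0.
have [->|y0] := eqVneq y 0.
  by rewrite /dotv mulmx0 mxE mulr_ge0// enorm_ge0.
have pos (z : 'cV[R]_n) : z != 0 -> 0 < enorm z.
  by move=> z0; rewrite sqrtr_gt0 lt0r dotvv_eq0 z0 dotvv_ge0.
have := dotvv_ge0 (enorm y *: x - enorm x *: y).
rewrite dotvDr dotvNr !dotvZr -![dotv (_ - _) _]dotvC !dotvDr !dotvNr !dotvZr.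
rewrite -!sqr_enorm (dotvC y x).
have := pos _ x0; have := pos _ y0.
move: (enorm x) (enorm y) (dotv x y) => a b t b0 a0 H.
have {}H : 0 <= (a * b) * (a * b - t) by lra.
by rewrite -subr_ge0 -(pmulr_rge0 _ (mulr_gt0 a0 b0)).
Qed.

Lemma enorm_triangle n (x y : 'cV[R]_n) : enorm (x + y) <= enorm x + enorm y.
Proof.
rewrite -(ler_pXn2r (ltn0Sn 1)) ?nnegrE ?addr_ge0 ?enorm_ge0//.
rewrite sqr_enorm dotvDr ![dotv (_ + _) _]dotvC !dotvDr (dotvC y x) -!sqr_enorm.
have := dotv_le_enorm x y.
by move: (enorm x) (enorm y) => a b H; lra.
Qed.

Lemma enormN n (x : 'cV[R]_n) : enorm (- x) = enorm x.
Proof. by rewrite /enorm dotvNr dotvC dotvNr opprK. Qed.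

Lemma enormZ n a (x : 'cV[R]_n) : 0 <= a -> enorm (a *: x) = a * enorm x.
Proof.
move=> a0; rewrite /enorm dotvZr dotvC dotvZr mulrA -expr2 sqrtrM ?sqr_ge0//.
by rewrite sqrtr_sqr ger0_norm.
Qed.

Lemma enorm_delta n (i : 'I_n) : enorm (delta_mx i 0 : 'cV[R]_n) = 1.
Proof.
rewrite /enorm dotvE (bigD1 i)//= big1 ?addr0 => [|j /negPf ji].
  by rewrite !mxE !eqxx mulr1 sqrtr1.
by rewrite !mxE ji mul0r.
Qed.

Lemma enorm_le_coord n (x : 'cV[R]_n) (t : R) : 0 <= t ->
  (forall i, `|x i 0| <= t) -> enorm x <= Num.sqrt n%:R * t.
Proof.
move=> t0 xt; rewrite -{1}(ger0_norm t0) -sqrtr_sqr -sqrtrM ?ler0n//.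
rewrite ler_wsqrtr// dotvE (le_trans (ler_sum _ (G := fun=> t ^+ 2) _))//.
  move=> i _; rewrite -expr2 -real_normK ?num_real//.
  by rewrite ler_sqr ?nnegrE.
by rewrite sumr_const card_ord mulr_natl.
Qed.

(** A hyperplane is stable under affine combinations, because the weights sum to 1. *)
Lemma affine_hull_dotv n (S : set 'cV[R]_n) (a : 'cV[R]_n) (t : R) :
  (forall x, S x -> dotv a x = t) ->
  forall y, affine_hull S y -> dotv a y = t.
Proof.
move=> H y [k [x [l [Sx l1 ->]]]]; rewrite dotv_sumr.
under eq_bigr do rewrite dotvZr H//.
by rewrite -mulr_suml l1 mul1r.
Qed.

(** Otherwise [S] lies in a hyperplane, hence so does its affine hull, the whole space. The points 0
    and [a] then give [t = 0] and [dotv a a = t], against [a != 0]. *)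
Lemma full_dimensional_dotv n (S : set 'cV[R]_n) (a : 'cV[R]_n) (t : R) :
  full_dimensional S -> a != 0 -> exists2 x, S x & dotv a x != t.
Proof.
move=> fS a0; apply/not_exists2P => H.
have {}H x : S x -> dotv a x = t.
  by move=> Sx; case: (H x) => // /negP; rewrite negbK => /eqP.
have Ha y : dotv a y = t.
  by apply: (@affine_hull_dotv _ S) => //; rewrite fS.
have t0 : t = 0 by rewrite -(Ha 0) /dotv mulmx0 mxE.
by move: a0; rewrite -dotvv_eq0 Ha t0 eqxx.
Qed.

(** * Interior points and inscribed balls of the polytope cut with the unit ball *)

Section polytope.
Variables (m n : nat) (A : 'M[R]_(m, n)) (b : 'cV[R]_m).
Hypotheses (n0 : (0 < n)%N) (m0 : (0 < m)%N)
  (A1 : forall i, enorm (row i A)^T = 1).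
Let S := ball_polytope A b.

(** Each row of [A] is nonzero, so some point of [S] satisfies the corresponding constraint
    strictly. The average [z] of these points satisfies all linear constraints strictly; a midpoint
    then makes the norm constraint strict too. *)
Lemma ball_polytope_slater : full_dimensional S ->
  exists x, (forall i, (A *m x) i 0 < b i 0) /\ enorm x < 1.
Proof.
move=> fS.
have /choice[x Hx] i : exists x, S x /\ (A *m x) i 0 < b i 0.
  have [|x Sx xb] := full_dimensional_dotv (a := (row i A)^T) (b i 0) fS.
    apply/eqP => a0; have := A1 i; rewrite a0 /enorm /dotv mulmx0 mxE sqrtr0.
    by move/eqP; rewrite eq_sym oner_eq0.
  exists x; split=> //; rewrite lt_neqAle mulmx_dotv xb /= -mulmx_dotv.
  by case: Sx => /(_ i).
have mR : 0 < m%:R :> R by rewrite ltr0n.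
pose z := m%:R^-1 *: \sum_i x i.
have zA i : (A *m z) i 0 < b i 0.
  rewrite mulmx_dotv dotvZr dotv_sumr mulrC ltr_pdivrMr//.
  rewrite (_ : b i 0 * _ = \sum_(j < m) b i 0); last first.
    by rewrite sumr_const card_ord mulr_natr.
  under eq_bigr do rewrite -mulmx_dotv.
  rewrite (bigD1 i)//= [ltRHS](bigD1 i)//= ltr_leD ?(Hx i).2//.
  by apply: ler_sum => j _; case: (Hx j) => -[] /(_ i).
have z1 : enorm z <= 1.
  rewrite enormZ ?invr_ge0 ?ler0n// mulrC ler_pdivrMr// mul1r.
  have -> : m%:R = \sum_(i < m) (1 : R) by rewrite sumr_const card_ord.
  elim/big_ind2 : _ => [|u r v s ur vs|i _]; last by case: (Hx i) => -[].
    by rewrite /enorm /dotv mulmx0 mxE sqrtr0.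
  by rewrite (le_trans (enorm_triangle _ _))// lerD.
(* A second point of [S] makes the norm of the midpoint strictly below 1. *)
pose i0 := Ordinal n0.
have [|y [yA y1]] := full_dimensional_dotv (a := delta_mx i0 0) (z i0 0) fS.
  by rewrite -dotvv_eq0 -sqr_enorm enorm_delta expr1n oner_eq0.
rewrite dotvE (bigD1 i0)//= big1 ?addr0; last first.
  by move=> j /negPf ji; rewrite mxE ji mul0r.
rewrite mxE !eqxx mul1r => yz.
exists (2^-1 *: (z + y)); split=> [i|].
  rewrite mulmx_dotv dotvZr dotvDr -!mulmx_dotv.
  by have := zA i; have := yA i; lra.
rewrite -(ltr_pXn2r (ltn0Sn 1)) ?nnegrE ?enorm_ge0 ?ler01// expr1n.
(* By the parallelogram identity, the squared norm of [z + y] is [2 * dotv z z + 2 * dotv y y - dotv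
   (z - y) (z - y)], which is less than 4. *)
have zy : 0 < dotv (z - y) (z - y).
  rewrite lt0r dotvv_ge0 dotvv_eq0 subr_eq0 andbT.
  by apply: contra yz => /eqP ->.
have z2 : dotv z z <= 1 by rewrite -sqr_enorm expr_le1// enorm_ge0.
have y2 : dotv y y <= 1 by rewrite -sqr_enorm expr_le1// enorm_ge0.
rewrite sqr_enorm dotvZr dotvC dotvZr.
move: zy; rewrite !dotvDr !dotvNr ![dotv (_ + _) _]dotvC !dotvDr !dotvNr.
by rewrite (dotvC y z); lra.
Qed.

(** Two antipodal points of the ball are [2 * r] apart, and both lie in the unit ball. *)
Lemma ball_polytope_radius_le1 x r :
  0 <= r -> closed_eball x r `<=` S -> r <= 1.
Proof.
move=> r0 BS; pose e : 'cV[R]_n := delta_mx (Ordinal n0) 0.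
have ne : enorm (r *: e) = r by rewrite enormZ// enorm_delta mulr1.
have [_ xp] : S (x + r *: e).
  by apply: BS; rewrite /closed_eball/= addrC addKr ne.
have [_ xm] : S (x - r *: e).
  by apply: BS; rewrite /closed_eball/= addrC addKr enormN ne.
have : enorm ((x + r *: e) - (x - r *: e)) <= 2.
  by rewrite (le_trans (enorm_triangle _ _))// enormN; lra.
rewrite opprB addrC addrA subrK -mulr2n -scaler_nat enormZ// ne; lra.
Qed.

(** The admissible radii are bounded by 1, and a strictly feasible point is the centre of a ball of
    positive radius. *)
Lemma fullness_gt0_le1 : full_dimensional S -> 0 < fullness S <= 1.
Proof.
move=> /ball_polytope_slater[x [xA x1]].
have ub : ubound [set r | 0 <= r /\ exists x, closed_eball x r `<=` S] 1.
  by move=> r [r0 [y]]; exact: ball_polytope_radius_le1.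
have [r r0 xr] : exists2 r, 0 < r & closed_eball x r `<=` S.
  (* The least slack at [x], with the slack of the norm constraint as default value. As the rows are
     unit vectors, a move of length at most [s] raises no coordinate of [A *m x] by more than
     [s]. *)
  pose s := \big[Num.min/1 - enorm x]_i (b i 0 - (A *m x) i 0).
  have s0 : 0 < s.
    rewrite /s; elim/big_ind : _ => [|u v u0 v0|i _]; last by rewrite subr_gt0.
      by rewrite subr_gt0.
    by rewrite lt_min u0.
  exists s => // y; rewrite /closed_eball /= => yx.
  have -> : y = x + (y - x) by rewrite addrC subrK.
  split=> [i|].
    rewrite mulmx_dotv dotvDr -mulmx_dotv.
    have := dotv_le_enorm (row i A)^T (y - x); rewrite A1 mul1r => H.
    have : s <= b i 0 - (A *m x) i 0 by exact: bigmin_le_cond.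
    lra.
  rewrite (le_trans (enorm_triangle _ _))//.
  have : s <= 1 - enorm x by exact: bigmin_le_id.
  by lra.
have Sr : [set r | 0 <= r /\ exists x, closed_eball x r `<=` S] r.
  by split; [exact: ltW|exists x].
apply/andP; split; first by rewrite (lt_le_trans r0)// ub_le_sup//; exists 1.
by rewrite ge_sup//; exists r.
Qed.

End polytope.
End euclidean.

Import HBNNSimple.

(** * Change of variables for the image under [X] of a measure with density [g] on [D] *)

Section weighted_law.
Context d (T : measurableType d) (R : realType).
Variable mu : {measure set T -> \bar R}.
Variables (D : set T) (g X : T -> R).
Hypotheses (mD : measurable D) (g0 : forall w, 0 <= g w)
  (mg : measurable_fun setT g) (mX : measurable_fun setT X).

Lemma weighted_integral_nnsfun (h : {nnsfun R >-> R}) :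
  (\int[mu]_(w in D) (g w * h (X w))%:E =
   \sum_(y \in range h)
     y%:E * \int[mu]_(w in D `&` X @^-1` (h @^-1` [set y])) (g w)%:E)%E.
Proof.
have mXh y : measurable (X @^-1` (h @^-1` [set y])).
  by rewrite -[X in measurable X]setTI; exact: mX.
have m1 y : measurable_fun D
    (fun w => (g w * \1_(X @^-1` (h @^-1` [set y])) w)%:E : \bar R).
  apply/measurable_EFinP; apply: measurable_funTS.
  by apply: measurable_funM => //; exact: measurable_indic.
transitivity (\int[mu]_(w in D) (\sum_(y \in range h)
    (y%:E * (g w * \1_(X @^-1` (h @^-1` [set y])) w)%:E)))%E.
  apply: eq_integral => w _.
  rewrite (fimfunE h) mulr_fsumr -fsumEFin//.
  by apply: eq_fsbigr => y _; rewrite -EFinM; congr (_%:E); rewrite mulrCA.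
rewrite ge0_integral_fsum//; last 2 first.
- by move=> y; apply: emeasurable_funM => //; exact: measurable_cst.
- move=> y w _; rewrite -EFinM lee_fin.
  (* Nonnegativity is required for every real [y]: either the level set is empty and its indicator
     vanishes, or [y] is a value of [h]. *)
  have [->|/set0P[x hx]] := eqVneq (X @^-1` (h @^-1` [set y])) set0.
    by rewrite indic0 !mulr0.
  rewrite mulr_ge0// ?mulr_ge0 ?indic_ge0//.
  by move: hx => /= <-; exact: fun_ge0.
apply: eq_fsbigr => y; rewrite inE => -[x _ <-].
rewrite ge0_integralZl//; last 2 first.
- by move=> w _; rewrite lee_fin mulr_ge0 ?indic_ge0.
- by rewrite lee_fin fun_ge0.
congr (_ * _)%E; rewrite integral_mkcondr; apply: eq_integral => w _.
by rewrite epatch_indic EFinM.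
Qed.

(** Monotone convergence along simple approximations of [f]. The right-hand side involves [X] only
    through weighted integrals over preimages. *)
Lemma weighted_integral_comp (f : R -> R)
    (mf : measurable_fun setT (EFin \o f : R -> \bar R)) :
  (forall x, 0 <= f x) ->
  (\int[mu]_(w in D) (g w * f (X w))%:E =
   limn (fun n => \sum_(y \in range (nnsfun_approx measurableT mf n)) y%:E *
     \int[mu]_(w in D `&`
       X @^-1` (nnsfun_approx measurableT mf n @^-1` [set y]))
       (g w)%:E))%E.
Proof.
move=> f0; set h := nnsfun_approx measurableT mf.
under [in RHS]eq_fun do rewrite -weighted_integral_nnsfun.
rewrite -monotone_convergence//.
- apply: eq_integral => w _; apply/esym/cvg_lim => //.
  under eq_fun do rewrite EFinM.
  rewrite EFinM; apply: cvgeZl => //.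
  by apply: (cvg_nnsfun_approx measurableT mf) => // x _; rewrite lee_fin.
- move=> n; apply/measurable_EFinP; apply: measurable_funTS.
  by apply: measurable_funM => //; exact: measurableT_comp.
- by move=> n w _; rewrite lee_fin mulr_ge0.
- move=> w _ m n mn; rewrite lee_fin ler_wpM2l//.
  exact/lefP/nd_nnsfun_approx.
Qed.

End weighted_law.

(** Two weighted image measures that agree on measurable sets agree against nonnegative measurable
    functions. This serves both to factor expectations and to replace a random variable by its
    density. *)
Lemma eq_weighted_law d1 d2 (T1 : measurableType d1) (T2 : measurableType d2)
    (R : realType) (mu1 : {measure set T1 -> \bar R})
    (mu2 : {measure set T2 -> \bar R})
    (D1 : set T1) (g1 X1 : T1 -> R) (D2 : set T2) (g2 X2 : T2 -> R) :
  measurable D1 -> measurable D2 ->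
  (forall w, 0 <= g1 w) -> (forall w, 0 <= g2 w) ->
  measurable_fun setT g1 -> measurable_fun setT g2 ->
  measurable_fun setT X1 -> measurable_fun setT X2 ->
  (forall B, measurable B ->
    \int[mu1]_(w in D1 `&` X1 @^-1` B) (g1 w)%:E =
    \int[mu2]_(w in D2 `&` X2 @^-1` B) (g2 w)%:E)%E ->
  forall f : R -> R, measurable_fun setT f -> (forall x, 0 <= f x) ->
  (\int[mu1]_(w in D1) (g1 w * f (X1 w))%:E =
   \int[mu2]_(w in D2) (g2 w * f (X2 w))%:E)%E.
Proof.
move=> mD1 mD2 g10 g20 mg1 mg2 mX1 mX2 E f mf f0.
have mEf : measurable_fun setT (EFin \o f : R -> \bar R).
  exact/measurable_EFinP.
rewrite (@weighted_integral_comp _ _ _ _ _ _ _ mD1 _ _ _ _ mEf)//.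
rewrite (@weighted_integral_comp _ _ _ _ _ _ _ mD2 _ _ _ _ mEf)//.
congr (limn _); apply/funext => n; apply: eq_fsbigr => y _.
by rewrite E.
Qed.

(** * Independence and Gaussian moment generating functions *)

Section gaussian.
Context disp (T : measurableType disp) (R : realType) (Pr : probability T R).

Lemma expectation_prod_independent (I : finType) (X : I -> T -> R)
    (f : I -> R -> R) (M : I -> R) :
  mutually_independent Pr X -> (forall i, measurable_fun setT (X i)) ->
  (forall i, measurable_fun setT (f i)) -> (forall i x, 0 <= f i x) ->
  (forall i, \int[Pr]_w (f i (X i w))%:E = (M i)%:E)%E ->
  (\int[Pr]_w (\prod_i f i (X i w))%:E = (\prod_i M i)%:E)%E.
Proof.
move=> indX mX mf f0 fM.
have mfX i : measurable_fun setT (fun w => f i (X i w)).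
  exact: measurableT_comp.
have mD (s : seq I) (B : I -> set R) : (forall i, measurable (B i)) ->
    measurable [set w | forall i, i \notin s -> B i (X i w)].
  move=> mB; rewrite (_ : [set _ | _] =
      \big[setI/setT]_(i <- index_enum I | i \notin s) (X i @^-1` B i)).
    apply: bigsetI_measurable => i _; rewrite -[X in measurable X]setTI.
    exact: mX.
  rewrite -bigcap_seq_cond; apply/seteqP; split=> w /= H i.
    by move=> /= /andP[_ si]; exact: H.
  by move=> si; apply: H; rewrite /= mem_index_enum.
(* Induction on [s]: the factors in [s] are general functions, the remaining
   ones are still indicators of [B i]. *)
suff H (s : seq I) : uniq s -> forall B : I -> set R,
    (forall i, measurable (B i)) ->
    (\int[Pr]_(w in [set w | forall i, i \notin s -> B i (X i w)])
      (\prod_(i <- s) f i (X i w))%:E =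
     (\prod_(i <- s) M i *
      \prod_(i | i \notin s) fine (Pr (X i @^-1` B i)))%:E)%E.
  have := H _ (index_enum_uniq I) (fun=> setT) (fun=> measurableT).
  rewrite [X in (_ * X)%:E]big_pred0 ?mulr1 => [<-|i]; last first.
    by rewrite mem_index_enum.
  congr (integral _ _ _); apply/esym/seteqP; by split.
elim: s => [_|k s IH /[!cons_uniq] /andP[ks us]] B mB.
  (* The empty product leaves the probability of an intersection, given by independence over the
     full index set. *)
  under eq_integral do rewrite big_nil.
  rewrite integral_cst ?mul1e; last exact: mD.
  rewrite big_nil mul1r; have := indX (finset.finset xpredT) B mB.
  under [in RHS]eq_bigl do rewrite inE.
  by move=> <-; congr (Pr _); apply/seteqP; split=> w /= H i _;
    apply: H; rewrite ?inE.
pose C := \prod_(i <- s) M i *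
  \prod_(i | i \notin k :: s) fine (Pr (X i @^-1` B i)).
have M0 i : 0 <= M i.
  by rewrite -lee_fin -fM integral_ge0// => w _; rewrite lee_fin.
have C0 : 0 <= C.
  by rewrite mulr_ge0// prodr_ge0// => i _; rewrite fine_ge0.
have prod0 w : 0 <= \prod_(i <- s) f i (X i w) by rewrite prodr_ge0.
have mprod : measurable_fun setT (fun w => \prod_(i <- s) f i (X i w)).
  exact: measurable_prod.
transitivity (\int[Pr]_(w in [set w | forall i, i \notin k :: s -> B i (X i w)])
    (\prod_(i <- s) f i (X i w) * f k (X k w))%:E)%E.
  by apply: eq_integral => w _; rewrite big_cons mulrC.
(* On the event, weighted by the product over [s], [X k] has the same weighted law as on all of [T]
   with the constant weight [C]. Integrating [f k] against both turns the indicator of index [k]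
   into a general factor. *)
have := @eq_weighted_law _ _ T T R Pr Pr
  [set w | forall i, i \notin k :: s -> B i (X i w)]
  (fun w => \prod_(i <- s) f i (X i w)) (X k) setT (fun=> C) (X k)
  (mD _ _ mB) measurableT prod0 (fun=> C0) mprod
  (measurable_cst _) (mX k) (mX k).
move=> -> //.
  under eq_integral do rewrite EFinM.
  rewrite ge0_integralZl//; last 2 first.
  - exact/measurable_EFinP.
  - by move=> w _; rewrite lee_fin.
  rewrite fM -EFinM big_cons; congr (_%:E); rewrite /C; ring.
move=> Bk mBk; rewrite setTI integral_cst//; last first.
  by rewrite -[X in measurable X]setTI; exact: mX.
(* Storing [Bk] at index [k] makes the condition on [X k] one of the remaining indicators, so that
   the induction hypothesis applies. *)
pose B' i := if i == k then Bk else B i.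
have mB' i : measurable (B' i) by rewrite /B'; case: ifP.
transitivity (\int[Pr]_(w in [set w | forall i, i \notin s -> B' i (X i w)])
      (\prod_(i <- s) f i (X i w))%:E)%E.
  congr (integral _ _ _); apply/seteqP; split=> w /=.
    move=> [H Hk] i si; rewrite /B'; case: eqP => [->//|/eqP ik].
    by apply: H; rewrite inE negb_or ik.
  move=> H; split=> [i|]; last by have := H k ks; rewrite /B' eqxx.
  rewrite inE negb_or => /andP[ik si].
  by have := H i si; rewrite /B' (negPf ik).
rewrite IH// (bigD1 k)//= {1}/B' eqxx mulrCA mulrC EFinM.
rewrite fineK ?fin_num_measure//.
  congr (_ * _)%E; congr (_%:E); congr (_ * _).
  apply: eq_big => [i|i /andP[_ /negPf ik]]; last by rewrite /B' ik.
  by rewrite inE negb_or andbC.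
by rewrite -[X in measurable X]setTI; exact: mX.
Qed.

(** Here [eq_weighted_law] compares [X] with weight 1 under [Pr] to the identity of the line with
    weight [normal_pdf 0 s]. *)
Lemma integral_normal_law (X : T -> R) (s : R) (f : R -> R) :
  measurable_fun setT X ->
  (forall B, measurable B -> Pr (X @^-1` B) = normal_prob 0 s B) ->
  measurable_fun setT f -> (forall x, 0 <= f x) ->
  (\int[Pr]_w (f (X w))%:E =
   \int[lebesgue_measure]_x (normal_pdf 0 s x * f x)%:E)%E.
Proof.
move=> mX lawX mf f0.
under eq_integral do rewrite -[f _]mul1r.
have := @eq_weighted_law _ _ T (measurableTypeR R) R Pr lebesgue_measure
  setT (fun=> 1) X setT (normal_pdf 0 s) id; apply => //.
- by move=> x; exact: normal_pdf_ge0.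
- exact: measurable_normal_pdf.
move=> B mB; rewrite !setTI integral_cst ?mul1e; first exact: lawX.
by rewrite -[_ @^-1` _]setTI; exact: mX.
Qed.

Lemma normal_mgf (X : T -> R) (s t : R) : s != 0 ->
  measurable_fun setT X ->
  (forall B, measurable B -> Pr (X @^-1` B) = normal_prob 0 s B) ->
  (\int[Pr]_w (expR (t * X w))%:E = (expR (s ^+ 2 * t ^+ 2 / 2))%:E)%E.
Proof.
move=> s0 mX lawX.
rewrite (@integral_normal_law X s (fun x => expR (t * x)))//; last first.
- by apply: measurableT_comp => //; exact: measurable_funM.
(* Completing the square shifts the mean to [s ^ 2 * t]. *)
transitivity (\int[lebesgue_measure]_x
  ((expR (s ^+ 2 * t ^+ 2 / 2))%:E * (normal_pdf (s ^+ 2 * t) s x)%:E))%E.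
  apply: eq_integral => x _; rewrite -EFinM; congr (_%:E).
  rewrite !normal_pdfE// /normal_fun -!mulrA -expRD.
  rewrite [RHS]mulrCA -expRD; congr (_ * expR _); field.
  exact: s0.
rewrite ge0_integralZl ?integral_normal_pdf ?mule1//.
- by apply/measurable_EFinP; exact: measurable_normal_pdf.
- by move=> x _; rewrite lee_fin normal_pdf_ge0.
Qed.

(** The exponential of a linear form in the entries is a product over index pairs, so independence
    reduces it to one-dimensional generating functions. *)
Lemma gaussian_matrix_mgf d n (s : R) (P : T -> 'M[R]_(d, n))
    (W : 'M[R]_(d, n)) :
  s != 0 -> iid_gaussian_matrix Pr s P ->
  (\int[Pr]_w (expR (\sum_i \sum_j W i j * P w i j))%:E =
   (expR (s ^+ 2 / 2 * \sum_i \sum_j W i j ^+ 2))%:E)%E.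
Proof.
move=> s0 [mP lawP indP].
pose f (ij : 'I_d * 'I_n) x := expR (W ij.1 ij.2 * x).
pose M (ij : 'I_d * 'I_n) := expR (s ^+ 2 * W ij.1 ij.2 ^+ 2 / 2).
have := @expectation_prod_independent _
  (fun (ij : 'I_d * 'I_n) (w : T) => P w ij.1 ij.2) f M indP
  (fun ij => mP ij.1 ij.2).
rewrite /f /M => H.
under eq_integral do rewrite pair_big expR_sum.
rewrite H ?pair_big/= ?mulr_sumr ?expR_sum => [|ij|ij x|ij].
- by congr (_%:E); apply: eq_bigr => ij _; congr expR; rewrite mulrAC.
- by apply: measurableT_comp => //; exact: measurable_funM.
- exact: expR_ge0.
- by apply: normal_mgf => // B; exact: lawP.
Qed.

End gaussian.

(** * Tail bounds for the image of a fixed vector under a Gaussian matrix *)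

Section tail.
Context disp (T : measurableType disp) (R : realType) (Pr : probability T R).
Variables (d n : nat) (s : R) (P : T -> 'M[R]_(d, n)).
Hypotheses (s0 : 0 < s) (gP : iid_gaussian_matrix Pr s P).

Lemma measurable_gaussian_coord (c : 'cV[R]_n) i :
  measurable_fun setT (fun w => (P w *m c) i 0).
Proof.
case: gP => mP _ _; under eq_fun do rewrite mxE.
apply: measurable_sum => j.
by apply: measurable_funM => //; exact: mP.
Qed.

Lemma gaussian_coord_tail (c : 'cV[R]_n) (tau : R) i :
  0 < enorm c -> 0 < tau ->
  (Pr [set w | (tau <= (P w *m c) i 0)%R] <=
   (expR (- (tau ^+ 2 / (2 * s ^+ 2 * enorm c ^+ 2))))%:E)%E.
Proof.
move=> c0 tau0.
pose Y w := (P w *m c) i 0.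
pose mY := isMeasurableFun.Build _ _ T R Y (measurable_gaussian_coord c i).
pose Y' : {RV Pr >-> R} := HB.pack Y mY.
(* The minimizer of the Chernoff exponent [s ^+ 2 * enorm c ^+ 2 * r ^+ 2 / 2 - r * tau]. *)
pose r := tau / (s ^+ 2 * enorm c ^+ 2).
have r0 : 0 < r by rewrite divr_gt0// mulr_gt0// exprn_gt0.
rewrite (le_trans (chernoff Y' tau r0))// /mmt_gen_fun unlock.
(* With [r *: c^T] as row [i] and zeros elsewhere, the linear form given by [W] is [r] times
   coordinate [i] of [P w *m c]. *)
pose W : 'M[R]_(d, n) := \matrix_(a, k) (if a == i then r * c k 0 else 0).
rewrite (_ : integral _ _ _ =
    (expR (s ^+ 2 / 2 * \sum_a \sum_k W a k ^+ 2))%:E).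
  have -> : \sum_a \sum_k W a k ^+ 2 = r ^+ 2 * enorm c ^+ 2.
    rewrite (bigD1 i)//= [X in _ + X]big1 ?addr0; last first.
      by move=> a /negPf ai; rewrite big1// => k _; rewrite mxE ai expr0n.
    rewrite sqr_enorm dotvE mulr_sumr; apply: eq_bigr => k _.
    by rewrite mxE eqxx; ring.
  rewrite -EFinM lee_fin -expRD ler_expR.
  rewrite le_eqVlt; apply/orP; left; apply/eqP; rewrite /r; field.
  by rewrite !gt_eqF.
rewrite -(gaussian_matrix_mgf W _ gP) ?gt_eqF//.
apply: eq_integral => w _; congr (_%:E); congr expR => /=.
rewrite (bigD1 i)//= [X in _ + X]big1 ?addr0; last first.
  move=> a /negPf ai; rewrite big1// => k _.
  by rewrite mxE ai mul0r.
rewrite /Y mxE mulr_suml; apply: eq_bigr => k _.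
by rewrite mxE eqxx; ring.
Qed.

(** A union bound over [2 * d] one-sided tails, those of [c] and of [- c] in each coordinate. Off
    these events every coordinate is below [tau] in absolute value. *)
Lemma gaussian_enorm_tail (c : 'cV[R]_n) (tau : R) :
  0 < enorm c -> 0 < tau ->
  with_probability_ge Pr
    (1 - 2 * d%:R * expR (- (tau ^+ 2 / (2 * s ^+ 2 * enorm c ^+ 2))))
    [set w | enorm (P w *m c) <= Num.sqrt d%:R * tau].
Proof.
move=> c0 tau0; set e := expR _.
pose G i :=
  [set w | tau <= (P w *m c) i 0] `|` [set w | tau <= (P w *m - c) i 0].
have mge (c' : 'cV[R]_n) i : measurable [set w | tau <= (P w *m c') i 0].
  rewrite -[X in measurable X]setTI.
  exact: (@measurable_fun_le _ _ _ setT (cst tau) _ measurableT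
    (measurable_cst _) (measurable_gaussian_coord c' i)).
have mG i : measurable (G i) by exact: measurableU.
have PG i : (Pr (G i) <= (2 * e)%:E)%E.
  rewrite (le_trans (measureU2 _ _ _))// mulr2n mulrDl mul1r EFinD leeD//.
    exact: gaussian_coord_tail.
  by rewrite /e -(enormN c); apply: gaussian_coord_tail; rewrite ?enormN.
pose U := \big[setU/set0]_i G i.
have mU : measurable U by exact: bigsetU_measurable.
have PU : (Pr U <= (2 * d%:R * e)%:E)%E.
  have -> : 2 * d%:R * e = \sum_(i < d) (2 * e).
    by rewrite sumr_const card_ord -mulr_natl; ring.
  rewrite -sumEFin /U.
  (* Measurability is carried through the induction because subadditivity for a union of two sets
     requires it. *)
  have : (measurable U /\ Pr U <= \sum_(i < d) (2 * e)%:E)%E; last by case.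
  rewrite /U; elim/big_ind2 : _ => //; first by rewrite measure0.
  move=> A x B y [mA PA] [mB PB].
  split; first exact: measurableU.
  by rewrite (le_trans (measureU2 _ _ _))// leeD.
exists (~` U); split; first exact: measurableC.
  rewrite /U -bigcup_seq => w Uw /=; apply: enorm_le_coord; first exact: ltW.
  move=> i; rewrite leNgt; apply/negP => tauw; apply: Uw.
  exists i => //=; first exact: mem_index_enum.
  move: tauw; rewrite lter_normr => /orP[|] /ltW taux; [by left|right].
  by rewrite /= mulmxN mxE.
by rewrite probability_setC// EFinB leeB.
Qed.

End tail.

(** * Comparison of the two optimal values and choice of the constants *)

Theorem theorem2p6 (R : realType) :
  exists C0 C1 : R, 1 < C0 /\ 1 / 4 < C1 /\
  forall (n d m : nat) (delta eps : R)
    (c : 'cV[R]_n) (b : 'cV[R]_m) (A : 'M[R]_(m, n))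
    (disp : measure_display) (T : measurableType disp)
    (Pr : probability T R) (P : T -> 'M[R]_(d, n)),
  (0 < n)%N -> (0 < d)%N -> (0 < m)%N ->
  0 < delta < 1 ->
  0 < eps < 1 / 2 ->
  (forall i, enorm (row i A)^T = 1) ->
  full_dimensional (ball_polytope A b) ->
  iid_gaussian_matrix Pr (Num.sqrt n%:R)^-1 P ->
  ln (m%:R / delta) / (C0 * eps ^+ 2) <= d%:R ->
  (d%:R + 1) * ln (2 * d%:R / delta) / (C1 * eps ^+ 2) <= n%:R ->
  with_probability_ge Pr (1 - 2 * delta)
    [set w : T | feas_minus A b (P w) eps !=set0 ->
      forall um up : 'cV[R]_d,
      is_argmin (proj_obj c (P w)) (feas_minus A b (P w) eps) um ->
      is_argmin (proj_obj c (P w)) (feas_plus A b (P w) eps) up ->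
      let xm := (P w)^T *m um in
      let xp := (P w)^T *m up in
      dotv c xp <= dotv c xm /\
      dotv c xm <=
        dotv c xp + 18 * eps / fullness (ball_polytope A b) * enorm c].
Proof.
exists 2, 1; split; first by lra.
split; first by lra.
move=> n d m delta eps c b A disp T Pr P n0 d0 m0 /andP[delta0 delta1].
move=> /andP[eps0 eps12] A1 fS gP _ nd.
have /andP[F0 F1] := fullness_gt0_le1 n0 m0 A1 fS.
set E := [set w : T | _].
have E_of w : enorm (P w *m c) <= 9 * eps * enorm c -> E w.
  move=> Pc _ um up [[umA um1] _] [[upA up1] upmin].
  rewrite !dotv_trmul; split.
    (* Enlarging [b] and the radius keeps [um] feasible, so the minimality of [up] gives the first
       inequality. *)
    apply: upmin; split; last by rewrite (le_trans um1)//; lra.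
    by move=> i; have := umA i; rewrite !mxE; lra.
  (* Cauchy-Schwarz bounds the gap by [enorm (P w *m c)] times the sum of the radii [1 - eps] and
     [1 + eps], that is 2; this gives [18 * eps * enorm c]. Dividing by [fullness], which is at most
     1, only enlarges the bound. *)
  have Hm := dotv_le_enorm (P w *m c) um.
  have Hp := dotv_le_enorm (P w *m c) (- up).
  rewrite dotvNr enormN in Hp.
  have := ler_wpM2l (enorm_ge0 (P w *m c)) um1.
  have := ler_wpM2l (enorm_ge0 (P w *m c)) up1.
  have : 18 * eps * enorm c <=
      18 * eps / fullness (ball_polytope A b) * enorm c.
    rewrite ler_wpM2r ?enorm_ge0// ler_pdivlMr// ler_piMr// mulr_ge0 ?ltW//.
  by lra.
(* The tail bound needs a nonzero [c]; for [c = 0] the norm bound holds everywhere. *)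
have [c0|c0] := eqVneq (enorm c) 0.
  exists setT; split=> //; last by rewrite probability_setT lee_fin; lra.
  move=> w _; apply: E_of; suff -> : c = 0.
    by rewrite mulmx0 /enorm /dotv !mulmx0 !mxE sqrtr0 mulr0.
  by apply/eqP; rewrite -dotvv_eq0 -sqr_enorm c0 expr0n.
have {}c0 : 0 < enorm c by rewrite lt0r c0 enorm_ge0.
have nR : 0 < n%:R :> R by rewrite ltr0n.
have dR : 0 < d%:R :> R by rewrite ltr0n.
have sd0 : 0 < Num.sqrt d%:R :> R by rewrite sqrtr_gt0.
have sn0 : 0 < Num.sqrt n%:R :> R by rewrite sqrtr_gt0.
have s0 : 0 < (Num.sqrt n%:R)^-1 :> R by rewrite invr_gt0.
(* Chosen so that [Num.sqrt d%:R * tau] is [9 * eps * enorm c]. *)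
pose tau := 9 * eps * enorm c / Num.sqrt d%:R.
have tau0 : 0 < tau by rewrite divr_gt0// !mulr_gt0.
have [F [mF FE PF]] := gaussian_enorm_tail s0 gP c0 tau0.
exists F; split=> //.
  move=> w /FE /= H; apply: E_of; rewrite (le_trans H)// /tau.
  by rewrite mulrC divfK// gt_eqF.
rewrite (le_trans _ PF)// lee_fin.
set L := ln (2 * d%:R / delta) in nd.
have L0 : 0 < L.
  rewrite ln_gt0// ltr_pdivlMr// mul1r.
  by have : 1 <= d%:R :> R; [rewrite ler1n|lra].
have -> : tau ^+ 2 / (2 * (Num.sqrt n%:R)^-1 ^+ 2 * enorm c ^+ 2) =
    81 / 2 * (n%:R * eps ^+ 2 / d%:R).
  rewrite -[in RHS](sqr_sqrtr (ltW nR)) -[in RHS](sqr_sqrtr (ltW dR)) /tau.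
  field.
  by rewrite (gt_eqF c0) (gt_eqF sd0) (gt_eqF sn0).
(* The bound on [n] with [C1 = 1], weakened from [d + 1] to [d]. *)
have H : L <= n%:R * eps ^+ 2 / d%:R.
  rewrite mul1r ler_pdivrMr ?exprn_gt0// in nd.
  by rewrite ler_pdivlMr// (le_trans _ nd)//; lra.
(* Since [expR (- L)] is [delta / (2 * d)], the failure probability is at most [delta]. *)
have : expR (- (81 / 2 * (n%:R * eps ^+ 2 / d%:R))) <= expR (- L).
  by rewrite ler_expR; lra.
rewrite [leRHS]expRN /L lnK ?posrE ?divr_gt0 ?mulr_gt0// invf_div.
rewrite ler_pdivlMr ?mulr_gt0//.
by lra.
Qed.
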